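(* Let $G$ be a locally compact group that has a compact open subgroup, and let $\mathcal P(G)$ be the space of polynomial functions in $C_c(G)$. Consider $C_c(G)$ with the convolution product $*$ and its involution $f\mapsto f^*$ (the convolution algebra). If $f,f'\in C_c(G)$ and at least one of $f,f'$ is polynomial, then $f*f'$ is polynomial. So $\mathcal P(G)$ is a two-sided $^*$-invariant ideal in the convolution algebra $C_c(G)$. It is a $^*$-subalgebra with local units, and its product is non-degenerate.
   Context: Locally compact groups are Hausdorff. $C_c(G)$ is the space of continuous complex functions on $G$ with compact support. For $f\in C_c(G)$ and $q\in G$, let $(q\cdot f)(p)=f(pq)$. A function $f\in C_c(G)$ is polynomial if there are an open neighborhood $V$ of the identity in $G$ and a finite-dimensional subspace $F$ of $C_c(G)$ such that $v\cdot f\in F$ for all $v\in V$. The convolution product is $(f*g)(p)=\int_G f(q)g(q^{-1}p)\,dq$, where $dq$ is a left Haar measure on $G$, and the involution is $f^*(p)=\delta(p)^{-1}\overline{f(p^{-1})}$, where $\delta$ is the modular function of $G$ (a continuous homomorphism $G\to\mathbb R^+$, normalized so that $\int f(q^{-1})\delta(q)^{-1}\,dq=\int f(q)\,dq$). An algebra $A$ has local units if for any finitely many $a_1,\dots,a_n\in A$ there is $u\in A$ with $ua_i=a_iu=a_i$ for all $i$. Its product is non-degenerate if $a\in A$ and $ab=0$ for all $b\in A$ imply $a=0$, and likewise $ba=0$ for all $b\in A$ implies $a=0$. *)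

(* Defs.v *)
From HB Require Import structures.
From mathcomp Require Import all_boot all_order all_algebra.
From mathcomp Require Import complex.
From mathcomp Require Import all_classical all_reals all_analysis.

Set Implicit Arguments.
Unset Strict Implicit.
Unset Printing Implicit Defensive.

Import Order.TTheory GRing.Theory Num.Theory.
Import numFieldNormedType.Exports.

Local Open Scope classical_set_scope.
Local Open Scope complex_scope.
Local Open Scope ring_scope.

(* R[i] carries the topology of its norm `|z|, which is its regular normed
   space structure; the library only declares the latter on the alias R[i]^o. *)
HB.instance Definition _ (R : realType) := NormedModule.copy R[i] R[i]^o.

(* Not necessarily Hausdorff. The base point is only there because the measure
   theory of the library asks for pointed types; it plays no other role. *)
HB.mixin Record isTopologicalGroup G & Group G & Topological G := {
  mulg_continuous : continuous (fun x : G * G => (x.1 * x.2)%g) ;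
  invg_continuous : continuous (fun x : G => (x^-1)%g)
}.

#[short(type="topologicalGroupType")]
HB.structure Definition TopologicalGroup :=
  {G of isTopologicalGroup G & Group G & PointedTopological G}.

Notation Borel G := (g_sigma_algebraType (@open G)).

Section linear.
Context {K : nzRingType} {V : lmodType K}.

Definition linear_span n (e : 'I_n -> V) : set V :=
  [set \sum_i c i *: e i | c in [set: 'I_n -> K]].

Definition subspace_of (A F : set V) : Prop :=
  F `<=` A /\ submod_closed [in F].

Definition finite_dimensional (F : set V) : Prop :=
  exists n (e : 'I_n -> V), F = linear_span e.

Variable mul : V -> V -> V.

Definition two_sided_ideal (A I : set V) : Prop :=
  subspace_of A I /\
  (forall a b, A a -> I b -> I (mul a b) /\ I (mul b a)).

Definition subalgebra (A B : set V) : Prop :=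
  subspace_of A B /\ (forall a b, B a -> B b -> B (mul a b)).

Definition has_local_units (A : set V) : Prop :=
  forall n (a : 'I_n -> V), (forall i, A (a i)) ->
  exists2 u, A u & forall i, mul u (a i) = a i /\ mul (a i) u = a i.

Definition nondegenerate_product (A : set V) : Prop :=
  (forall a, A a -> (forall b, A b -> mul a b = 0) -> a = 0) /\
  (forall a, A a -> (forall b, A b -> mul b a = 0) -> a = 0).

End linear.

Definition star_invariant (V : Type) (star : V -> V) (A : set V) : Prop :=
  forall a, A a -> A (star a).

Definition star_subalgebra {K : nzRingType} {V : lmodType K}
    (mul : V -> V -> V) (star : V -> V) (A B : set V) : Prop :=
  subalgebra mul A B /\ star_invariant star B.

Section group.
Context {R : realType} {G : topologicalGroupType}.
Implicit Types (f g : G -> R[i]) (p q : G).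

Definition is_subgroup (H : set G) : Prop := group_closed [in H].

Definition Cc : set (G -> R[i]) :=
  [set f | continuous f /\ compact (closure [set p | f p != 0])].

Definition translate q f : G -> R[i] := fun p => f (p * q)%g.

Definition polynomial_fun : set (G -> R[i]) :=
  [set f | Cc f /\ exists V F, [/\ open_nbhs 1%g V, subspace_of Cc F,
     finite_dimensional F & forall v, V v -> F (translate v f)]].

Variable mu : {measure set (Borel G) -> \bar R}.

(* A nonzero left-invariant Radon measure: finite on compact sets, outer regular
   on Borel sets and inner regular on open sets. *)
Definition left_haar_measure : Prop :=
  [/\ mu setT != 0%E,
      forall (p : G) (A : set (Borel G)), measurable A ->
        mu [set (p * q)%g | q in A] = mu A,
      forall K : set G, compact K -> (mu K < +oo)%E,
      forall A : set (Borel G), measurable A ->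
        mu A = ereal_inf [set mu U | U in [set U : set G | open U /\ A `<=` U]] &
      forall U : set G, open U ->
        mu U = ereal_sup [set mu K | K in [set K : set G | compact K /\ K `<=` U]]].

Definition cintegral f : R[i] :=
  (\int[mu]_(q in setT) complex.Re (f q)) +i*
  (\int[mu]_(q in setT) complex.Im (f q)).

Definition modular_function (delta : G -> R) : Prop :=
  [/\ continuous delta,
      forall p, 0 < delta p,
      forall p q, delta (p * q)%g = delta p * delta q &
      forall f, Cc f ->
        cintegral (fun q => f (q^-1)%g * ((delta q)^-1)%:C) = cintegral f].

Definition convolution f g : G -> R[i] :=
  fun p => cintegral (fun q => f q * g (q^-1 * p)%g).

Definition involution (delta : G -> R) f : G -> R[i] :=
  fun p => ((delta p)^-1)%:C * conjc (f (p^-1)%g).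

End group.

Arguments Cc R G : clear implicits.
Arguments polynomial_fun R G : clear implicits.

(* Main.v *)
Require Import Defs.
From HB Require Import structures.
From mathcomp Require Import all_boot all_order all_algebra.
From mathcomp Require Import complex.
From mathcomp Require Import all_classical all_reals all_analysis.
From mathcomp Require Import measurable_realfun.

(** The whole proof rests on one encoding: a test function [f] is polynomial if
    and only if the kernel [(p, v) |-> f (p * v)] has finite rank when [v] is
    restricted to a neighborhood of the identity ([polynomialP]). This notion
    is two-sided. Near a point [s], left translates of [f] factor through right
    ones by [v * p = (v * s) * (s^-1 * p)], and since [f] has compact support,
    finitely many [s] suffice to factor [(v, p) |-> f (v * p)] for [v] in any
    compact set ([right_left_finite]); inversion gives the converse.

    A convolution is then polynomial as soon as one factor is: right translation
    acts on the second factor only, and left translation on the first one by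
    invariance of the Haar measure. The continuity of the convolution comes for
    free from the same computation: a kernel of finite rank is recovered from
    finitely many of its own rows and columns ([finite_rank_skeleton]), so that
    the coordinates of the translates of a continuous polynomial function
    depend continuously on the translation
    ([right_finite_expansion], [right_expansion_continuous]).
    Invariance under the involution follows from two-sidedness.

    For local units, let [H] be a compact open subgroup. A function [u] supported
    in [H] is a left unit for [a] if the integral of [k |-> u k * a (k^-1 * p)]
    over [H] is [a p] for all [p], and, after the substitution allowed by the
    modular function, a right unit if the same holds for the functions
    [k |-> u k * a (p * k^-1) / delta k]. In other words, integration against [u]
    must be evaluation at the identity on a family of functions supported in [H].
    For finitely many polynomial [a] these functions span a finite-dimensional
    space, on which the inner product given by the Haar measure is definite; so
    evaluation is the inner product with a member of that space
    ([Riesz_evaluation]), whose conjugate is the required [u]. It is polynomial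
    because all the functions of that space are. One function thus serves as a
    unit on both sides, and non-degeneracy is an immediate consequence. *)

Set Implicit Arguments.
Unset Strict Implicit.
Unset Printing Implicit Defensive.
Import Order.TTheory GRing.Theory Num.Theory.
Import numFieldNormedType.Exports.
Local Open Scope classical_set_scope.
Local Open Scope ring_scope.

(** * Kernels of finite rank *)

Section finite_rank.
Context {K : fieldType} {X Y : Type}.
Implicit Types (A : set X) (B : set Y) (k : X -> Y -> K).

(** Functions of two variables that factor through a finite-dimensional space,
    on a rectangle only: the factors may depend badly on the variables, which
    is what makes the gluing of local factorizations trivial. *)
Definition finite_rank A B k := exists n (a : X -> 'rV[K]_n) (b : Y -> 'cV[K]_n),
  forall x y, A x -> B y -> k x y = (a x *m b y) 0 0.

Lemma eq_finite_rank A B k k' :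
  (forall x y, A x -> B y -> k x y = k' x y) ->
  finite_rank A B k -> finite_rank A B k'.
Proof.
move=> kk' [n [a [b kE]]]; exists n, a, b => x y Ax By.
by rewrite -kk' ?kE.
Qed.

Lemma finite_rank1 A B (a : X -> K) (b : Y -> K) :
  finite_rank A B (fun x y => a x * b y).
Proof.
exists 1%N, (fun x => (a x)%:M), (fun y => (b y)%:M) => x y _ _.
by rewrite -scalar_mxM mxE.
Qed.

Lemma finite_rankD A B k k' : finite_rank A B k -> finite_rank A B k' ->
  finite_rank A B (fun x y => k x y + k' x y).
Proof.
move=> [n [a [b kE]]] [n' [a' [b' kE']]].
exists (n + n')%N, (fun x => row_mx (a x) (a' x)),
  (fun y => col_mx (b y) (b' y)) => x y Ax By.
by rewrite mul_row_col mxE kE ?kE'.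
Qed.

Lemma finite_rankM A B (a : X -> K) (b : Y -> K) k : finite_rank A B k ->
  finite_rank A B (fun x y => a x * b y * k x y).
Proof.
move=> [n [a' [b' kE]]].
exists n, (fun x => a x *: a' x), (fun y => b y *: b' y) => x y Ax By.
by rewrite -scalemxAl -scalemxAr scalerA mxE kE.
Qed.

Lemma finite_rank_sum (I : finType) A B (k : I -> X -> Y -> K) :
  (forall i, finite_rank A B (k i)) ->
  finite_rank A B (fun x y => \sum_i k i x y).
Proof.
move=> kP; suff H s : finite_rank A B (fun x y => \sum_(i <- s) k i x y) by [].
elim: s => [|i s IHs].
  apply: eq_finite_rank (finite_rank1 _ _ (fun=> 0) (fun=> 0)) => x y _ _.
  by rewrite big_nil mulr0.
apply: eq_finite_rank (finite_rankD (kP i) IHs) => x y _ _.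
by rewrite big_cons.
Qed.

(** The pieces need not be disjoint nor the factorizations agree on the overlap:
    on [B] the first one is used, elsewhere the second one. *)
Lemma finite_rankU A B B' k : finite_rank A B k -> finite_rank A B' k ->
  finite_rank A (B `|` B') k.
Proof.
move=> kB kB'.
have [n [a [b kE]]] := kB; have [n' [a' [b' kE']]] := kB'.
exists (n + n')%N, (fun x => row_mx (a x) (a' x)),
  (fun y => if pselect (B y) then col_mx (b y) 0 else col_mx 0 (b' y)) => x y Ax By.
case: pselect => [By'|nBy]; rewrite mul_row_col mulmx0 ?addr0 ?add0r.
  by rewrite kE.
by case: By => // By'; rewrite kE'.
Qed.

(** Schur complement of an invertible block. *)
Lemma det_bordered n (M : 'M[K]_n) (u : 'cV_n) (v : 'rV_n) (c : K) :
  M \in unitmx -> \det (block_mx M u v c%:M) =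
  \det M * (c - (v *m invmx M *m u) 0 0).
Proof.
move=> Mu.
have -> : block_mx M u v c%:M =
   block_mx 1%:M 0 (v *m invmx M) 1%:M *m
   block_mx M u 0 (c%:M - v *m invmx M *m u).
  rewrite mulmx_block !mul1mx !mul0mx !addr0 mulmxKV //.
  by rewrite addrCA subrr addr0.
by rewrite det_mulmx det_lblock det_ublock !det1 !mul1r det_mx11 !mxE eqxx mulr1n.
Qed.

(** A kernel of finite rank is recovered from finitely many of its rows and
    columns: an invertible minor [k (x i) (y j)] of maximal size has vanishing
    bordered minors, and by the Schur complement this is the formula below,
    with [N] the inverse of the minor. Thus the abstract factors can always be
    taken among the partial functions of [k], and inherit their regularity. *)
Lemma finite_rank_skeleton A B k : finite_rank A B k ->
  exists d (x : 'I_d -> X) (y : 'I_d -> Y) (N : 'M[K]_d),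
    [/\ forall i, A (x i), forall j, B (y j) &
      forall p q, A p -> B q ->
        k p q = \sum_j \sum_i k p (y j) * N j i * k (x i) q].
Proof.
move=> [n [a [b kE]]].
pose minor d (x : 'I_d -> X) (y : 'I_d -> Y) := \matrix_(i, j) k (x i) (y j).
pose P d := `[< exists (x : 'I_d -> X) (y : 'I_d -> Y),
  [/\ forall i, A (x i), forall j, B (y j) & \det (minor d x y) != 0] >].
have P0 : P 0%N.
  have f0 (T : Type) : 'I_0 -> T by case.
  apply/asboolP; exists (f0 X), (f0 Y); split; [by case|by case|].
  by rewrite det_mx00 oner_neq0.
have Pn d : P d -> (d <= n)%N.
  move=> /asboolP [x [y [Ax By]]]; rewrite -unitfE -[_ \is a _]/(_ \in unitmx).
  rewrite -row_full_unit => /eqP <-.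
  have -> : minor d x y = (\matrix_i a (x i)) *m (\matrix_(i, j) b (y j) i 0).
    apply/matrixP => i j; rewrite !mxE kE // mxE.
    by apply: eq_bigr => l _; rewrite !mxE.
  by rewrite (leq_trans (mulmx_max_rank _ _)).
case: (ex_maxnP (ex_intro P 0%N P0) Pn) => d /asboolP[x [y [Ax By Md]]] dmax.
set M := minor d x y in Md; have Mu : M \in unitmx by rewrite unitmxE unitfE.
exists d, x, y, (invmx M); split=> // p q Ap Bq.
pose x' (i : 'I_(d + 1)) := if fintype.split i is inl i' then x i' else (p : X).
pose y' (i : 'I_(d + 1)) := if fintype.split i is inl i' then y i' else (q : Y).
have M'E : minor (d + 1)%N x' y' = block_mx M (\col_i k (x i) q)
    (\row_j k p (y j)) (k p q)%:M.
  apply/matrixP => i j; rewrite !mxE /x' /y'.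
  case: fintype.splitP => i' Ei; rewrite mxE; case: fintype.splitP => j' Ej;
    rewrite ?mxE //.
  by rewrite ord1 (ord1 j') eqxx mulr1n.
(* By maximality of [d] the minor bordered by [p] and [q] vanishes. *)
have := det_bordered (\col_i k (x i) q) (\row_j k p (y j)) (k p q) Mu.
rewrite -M'E => detE.
have : ~~ P (d + 1)%N by apply/negP => /dmax; rewrite addn1 ltnn.
move=> /asboolP/forallNP/(_ x')/forallNP/(_ y') nP.
have /eqP : \det (minor (d + 1)%N x' y') == 0.
  apply/negP => /negP ?; apply: nP; split=> // i; rewrite /x' /y'.
    by case: fintype.split.
  by case: fintype.split.
rewrite detE => /eqP; rewrite mulf_eq0 (negbTE Md) /= subr_eq0 => /eqP ->.
rewrite mxE exchange_big; apply: eq_bigr => i _ /=.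
by rewrite !mxE mulr_suml; apply: eq_bigr => j _; rewrite !mxE.
Qed.
End finite_rank.

Lemma finite_rank_comp (K : fieldType) (X X' Y Y' : Type)
    (A : set X) (A' : set X') (B : set Y) (B' : set Y')
    (f : X' -> X) (g : Y' -> Y) (k : X -> Y -> K) :
  (forall x, A' x -> A (f x)) -> (forall y, B' y -> B (g y)) ->
  finite_rank A B k -> finite_rank A' B' (fun x y => k (f x) (g y)).
Proof.
move=> fA gB [n [a [b kE]]]; exists n, (a \o f), (b \o g) => x y A'x B'y.
by rewrite kE //; [exact: fA|exact: gB].
Qed.

Lemma finite_rank_tr (K : fieldType) (X Y : Type) (A : set X) (B : set Y)
    (k : X -> Y -> K) :
  finite_rank A B k -> finite_rank B A (fun y x => k x y).
Proof.
move=> [n [a [b kE]]]; exists n, (fun y => (b y)^T), (fun x => (a x)^T).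
by move=> y x By Ax; rewrite -trmx_mul mxE kE.
Qed.

Lemma finite_rank_map (K : fieldType) (X Y : Type) (A : set X) (B : set Y)
    (k : X -> Y -> K) (phi : {rmorphism K -> K}) :
  finite_rank A B k -> finite_rank A B (fun x y => phi (k x y)).
Proof.
move=> [n [a [b kE]]].
exists n, (fun x => map_mx phi (a x)), (fun y => map_mx phi (b y)) => x y Ax By.
by rewrite -map_mxM [RHS]mxE kE.
Qed.

(** * Continuity, compactness and the space of test functions *)

Lemma continuous_fun_comp (S T U : topologicalType) (f : S -> T) (g : T -> U) :
  continuous f -> continuous g -> continuous (fun x => g (f x)).
Proof. by move=> cf cg x A /cg/cf. Qed.

Lemma continuous_near_eq (T U : topologicalType) (p : T) (f g : T -> U) :
  f p = g p -> (\forall x \near p, f x = g x) -> {for p, continuous g} ->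
  {for p, continuous f}.
Proof.
move=> fgp fg cg A; rewrite fgp => /cg gA.
by apply: filterS2 fg gA => x /= ->.
Qed.

Section complex_topology.
Context {R : realType}.

Lemma near_dist_complex (z : R[i]) (e : R) : 0 < e ->
  \forall x \near z, `|z - x| < (e%:C)%C.
Proof.
move=> e0; apply/nbhs_ballP; exists (e%:C)%C; first by rewrite /= ltcR.
by move=> x; rewrite -ball_normE.
Qed.

Lemma continuous_Re : continuous (@complex.Re R : R[i] -> R).
Proof.
move=> z A /nbhs_ballP[e /= e0 eA].
apply: (@filterS _ _ (nbhs_filter z) _ _ _ (near_dist_complex z e0)) => x xz.
apply: eA; rewrite -ball_normE /= -ltcR; apply: le_lt_trans xz.
by have := normc_ge_Re (z - x); case: (z) (x) => [? ?] [? ?].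
Qed.

Lemma continuous_conjc : continuous (@conjc R : R[i] -> R[i]).
Proof.
move=> z A /nbhs_ballP[[e e'] /=]; rewrite ltcE /= => /andP[/eqP -> e0] eA.
apply: (@filterS _ _ (nbhs_filter z) _ _ _ (near_dist_complex z e0)) => x xz.
by apply: eA; rewrite -ball_normE /= -rmorphB /= normcJ.
Qed.

Lemma continuousM_complex (T : topologicalType) (f g : T -> R[i]) :
  continuous f -> continuous g -> continuous (fun x => f x * g x).
Proof. by move=> cf cg x; apply: cvgM; [exact: cf|exact: cg]. Qed.

Lemma continuousD_complex (T : topologicalType) (f g : T -> R[i]) :
  continuous f -> continuous g -> continuous (fun x => f x + g x).
Proof. by move=> cf cg x; apply: cvgD; [exact: cf|exact: cg]. Qed.

Lemma continuous_Im : continuous (@complex.Im R : R[i] -> R).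
Proof.
have -> : @complex.Im R = (fun z : R[i] => - complex.Re (z * 'i%C)).
  by apply/funext => z; rewrite ReiNIm opprK.
have ci : continuous (fun z : R[i] => z * 'i%C).
  by apply: continuousM_complex => [z //|]; exact: cst_continuous.
have cN : continuous (fun x : R => - x) by move=> x; apply: cvgN; exact: cvg_id.
exact: continuous_fun_comp (continuous_fun_comp ci continuous_Re) cN.
Qed.

Lemma continuous_real_complex : continuous (fun x : R => (x%:C)%C).
Proof.
move=> x; apply/cvgrPdist_lt => -[e e'] /=; rewrite ltcE /= => /andP[/eqP -> e0].
near=> y; rewrite -rmorphB /= normc_def /= expr0n addr0 sqrtr_sqr ltcR.
by near: y; apply: cvgr_dist_lt => //; exact: cvg_id.
Unshelve. all: by end_near. Qed.

Lemma continuous_sum (T : topologicalType) n (c : 'I_n -> T -> R[i]) :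
  (forall i, continuous (c i)) -> continuous (fun x => \sum_i c i x).
Proof.
move=> cc; suff H s : continuous (fun x => \sum_(i <- s) c i x) by [].
elim: s => [|i s IHs].
  by under eq_fun do rewrite big_nil; exact: cst_continuous.
by under eq_fun do rewrite big_cons; exact: (continuousD_complex (cc i) IHs).
Qed.

Lemma continuousZ_complex (T : topologicalType) (c : R[i]) (f : T -> R[i]) :
  continuous f -> continuous (fun x => c * f x).
Proof.
have cc : continuous (fun _ : T => c) by exact: cst_continuous.
by move=> cf; exact: (continuousM_complex cc cf).
Qed.

End complex_topology.

(** A property of sets stable under subsets and finite unions passes from local
    to compact sets: otherwise the complements of the sets that have it generate
    a proper filter on [S] without cluster point. *)
Lemma compact_ideal_ind (T : topologicalType) (I : set (set T)) (S : set T) :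
  I set0 -> (forall A B, A `<=` B -> I B -> I A) ->
  (forall A B, I A -> I B -> I (A `|` B)) ->
  compact S -> (forall s, S s -> exists2 N, nbhs s N & I N) -> I S.
Proof.
move=> I0 Isub IU cS locI; apply: contrapT => nIS.
pose F := [set A | I (S `\` A)].
have FF : ProperFilter F.
  split; first by rewrite /F /= setD0.
  split; first by rewrite /F /= setDT.
    by move=> A B FA FB; rewrite /F /= setDIr; exact: IU.
  by move=> A B AB; apply: Isub => x [Sx nBx]; split=> // /AB.
have [s [Ss sF]] : S `&` cluster F !=set0 by apply: cS; rewrite /F /= setDv.
have [N sN IN] := locI _ Ss.
have FN : F (~` N) by apply: Isub IN => x [_ /contrapT].
by have [x []] := sF _ _ FN sN.
Qed.

Section group_topology.
Context {G : topologicalGroupType}.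
Implicit Types (p q : G) (A B C : set G).

Lemma continuous_mulg (T : topologicalType) (f g : T -> G) :
  continuous f -> continuous g -> continuous (fun x => (f x * g x)%g).
Proof.
move=> cf cg.
apply: (@continuous_fun_comp _ _ _ (fun x => (f x, g x))
  (fun x : G * G => (x.1 * x.2)%g)); last exact: mulg_continuous.
by move=> x; apply: cvg_pair; [exact: cf|exact: cg].
Qed.

Lemma continuous_mulgl p : continuous (fun q => p * q)%g.
Proof. by apply: continuous_mulg => x; [exact: cvg_cst|exact: cvg_id]. Qed.

Lemma continuous_mulgr p : continuous (fun q => q * p)%g.
Proof. by apply: continuous_mulg => x; [exact: cvg_id|exact: cvg_cst]. Qed.

Lemma compact_invg C : compact C -> compact [set (p^-1)%g | p in C].
Proof.
by apply: continuous_compact; apply: continuous_subspaceT; exact: invg_continuous.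
Qed.

Lemma compact_mulg A B : compact A -> compact B ->
  compact [set (x.1 * x.2)%g | x in A `*` B].
Proof.
move=> cA cB; apply: continuous_compact; last exact: compact_setX.
by apply: continuous_subspaceT; exact: mulg_continuous.
Qed.

Lemma open_translate p A : open A -> open [set (p * q)%g | q in A].
Proof.
move=> oA; have -> : [set (p * q)%g | q in A] = (fun q => p^-1 * q)%g @^-1` A.
  apply/seteqP; split=> [_ [q Aq <-]|q Aq] /=; first by rewrite mulKg.
  by exists (p^-1 * q)%g; rewrite // mulVKg.
by apply: open_comp => // q _; exact: continuous_mulgl.
Qed.

Lemma nbhs_translate p q A : nbhs q A -> nbhs (p * q)%g [set (p * q)%g | q in A].
Proof.
rewrite nbhsE => -[U [oU Uq] UA]; rewrite nbhsE.
exists [set (p * q)%g | q in U]; last exact: image_subset.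
by split; [exact: open_translate|exists q].
Qed.

End group_topology.

Section Cc.
Context {R : realType} {G : topologicalGroupType}.
Hypothesis hG : hausdorff_space G.
Implicit Types (f g : G -> R[i]) (p q : G).

(** In a Hausdorff space it suffices to enclose the support in any compact set. *)
Lemma CcP f : Cc R G f <->
  continuous f /\ exists2 C, compact C & forall p, f p != 0 -> C p.
Proof.
split=> [[cf cS]|[cf [C cC fC]]]; split=> //.
  by exists (closure [set p | f p != 0]) => // p fp; exact: subset_closure.
apply: (subclosed_compact _ cC); first exact: closed_closure.
rewrite closureE => x /(_ C); apply; split=> //.
exact: compact_closed.
Qed.

Lemma Cc_continuous f : Cc R G f -> continuous f.
Proof. by case. Qed.

Lemma Cc_mul f g : Cc R G f -> continuous g -> Cc R G (fun p => f p * g p).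
Proof.
move=> /CcP[cf [C cC fC]] cg; apply/CcP; split.
  exact: (continuousM_complex cf cg).
by exists C => // p; rewrite mulf_eq0 negb_or => /andP[/fC].
Qed.

Lemma Cc_add f g : Cc R G f -> Cc R G g -> Cc R G (fun p => f p + g p).
Proof.
move=> /CcP[cf [C cC fC]] /CcP[cg [D cD gD]]; apply/CcP; split.
  exact: (continuousD_complex cf cg).
exists (C `|` D); first exact: compactU.
move=> p fg; have [f0|/eqP/fC] := pselect (f p = 0); last by left.
by right; apply: gD; move: fg; rewrite f0 add0r.
Qed.

Lemma Cc0 : Cc R G (fun=> 0).
Proof.
apply/CcP; split; first by move=> p; exact: cvg_cst.
by exists set0; [exact: compact0|move=> p; rewrite eqxx].
Qed.

Lemma Cc_sum n (c : 'I_n -> R[i]) (e : 'I_n -> G -> R[i]) :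
  (forall i, Cc R G (e i)) -> Cc R G (fun p => \sum_i c i * e i p).
Proof.
move=> Ce; suff H s : Cc R G (fun p => \sum_(i <- s) c i * e i p) by [].
elim: s => [|i s IHs].
  by under eq_fun do rewrite big_nil; exact: Cc0.
under eq_fun do rewrite big_cons mulrC.
by apply: Cc_add => //; apply: Cc_mul => // p; exact: cvg_cst.
Qed.

Lemma Cc_conj f : Cc R G f -> Cc R G (fun p => conjc (f p)).
Proof.
move=> /CcP[cf [C cC fC]]; apply/CcP; split.
  exact: continuous_fun_comp cf continuous_conjc.
by exists C => // p; rewrite conjc_eq0 => /fC.
Qed.

Lemma Cc_comp (phi psi : G -> G) f : continuous phi -> continuous psi ->
  cancel phi psi -> Cc R G f -> Cc R G (f \o phi).
Proof.
move=> cphi cpsi phiK /CcP[cf [C cC fC]]; apply/CcP; split.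
  exact: continuous_fun_comp cphi cf.
exists (psi @` C).
  by apply: continuous_compact => //; exact: continuous_subspaceT.
by move=> p /fC Cp; exists (phi p).
Qed.

Lemma Cc_inv f : Cc R G f -> Cc R G (fun p => f (p^-1)%g).
Proof.
by apply: Cc_comp; [exact: invg_continuous|exact: invg_continuous|exact: invgK].
Qed.

Lemma Cc_mulgl p f : Cc R G f -> Cc R G (fun q => f (p * q)%g).
Proof.
apply: (Cc_comp (phi := fun q => p * q) (psi := fun q => p^-1 * q))%g.
- exact: continuous_mulgl.
- exact: continuous_mulgl.
- exact: mulKg.
Qed.

Lemma Cc_translate p f : Cc R G f -> Cc R G (translate p f).
Proof.
apply: (Cc_comp (phi := fun q => q * p) (psi := fun q => q * p^-1))%g.
- exact: continuous_mulgr.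
- exact: continuous_mulgr.
- exact: mulgK.
Qed.

End Cc.

(** * Polynomial functions as finite rank kernels *)

Section one_sided_finiteness.
Context {R : realType} {G : topologicalGroupType}.
Hypothesis hG : hausdorff_space G.
Implicit Types (f g : G -> R[i]) (p q : G) (V W C : set G).

Definition right_finite V f := finite_rank setT V (fun p v => f (p * v)%g).

Definition left_finite V f := finite_rank V setT (fun v p => f (v * p)%g).

Lemma right_finite_inv V W f : (forall w, W w -> V (w^-1)%g) ->
  left_finite V f -> right_finite W (fun p => f (p^-1)%g).
Proof.
move=> WV /finite_rank_tr fV.
apply: eq_finite_rank (finite_rank_comp (f := fun p => (p^-1)%g)
  (g := fun v => (v^-1)%g) _ WV fV); last by [].
by move=> p v _ _; rewrite invgM.
Qed.

(** Write [v * p = (v * s) * (s^-1 * p)]: for [p] in [s * V] the second factor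
    is in [V], so right finiteness factors [f (v * p)] for all [v] and for [p]
    near [s]. For [v] in the compact set [C], only the [p] in the compact set
    [C^-1 * S] matter, [S] containing the support of [f]; finitely many
    neighborhoods [s * V] cover it. *)
Lemma right_left_finite V C f : Cc R G f -> nbhs 1%g V -> compact C ->
  right_finite V f -> left_finite C f.
Proof.
move=> /(CcP hG)[_ [S cS fS]] V1 cC fV.
pose D := [set (x.1 * x.2)%g | x in [set (p^-1)%g | p in C] `*` S].
have cD : compact D by apply: compact_mulg => //; exact: compact_invg.
have fD : finite_rank C D (fun v p => f (v * p)%g).
  pose I B := finite_rank C B (fun v p => f (v * p)%g).
  apply: (@compact_ideal_ind _ I) => //.
  - by exists 0%N, (fun=> 0), (fun=> 0).
  - by move=> A B AB; apply: (finite_rank_comp (f := id) (g := id)).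
  - by move=> A B; exact: finite_rankU.
  move=> s _; exists [set (s * q)%g | q in V].
    by rewrite -[X in nbhs X]mulg1; exact: nbhs_translate.
  apply: (eq_finite_rank _ (finite_rank_comp (f := fun v => (v * s)%g)
    (g := fun p => (s^-1 * p)%g) _ _ fV)) => //.
    by move=> v p _ _; rewrite -mulgA mulVKg.
  by move=> _ [q Vq <-]; rewrite mulKg.
rewrite /left_finite -(setUv D); apply: finite_rankU => //.
apply: (eq_finite_rank _ (finite_rank1 C (~` D) (fun=> 0) (fun=> 0))) => v p Cv nDp.
rewrite mulr0; apply/esym/eqP; apply: contra_notT nDp => /fS Svp.
by exists (v^-1, v * p)%g; rewrite /= ?mulKg //; split=> //=; exists v.
Qed.

Lemma left_right_finite V C f : Cc R G f -> nbhs 1%g V -> compact C ->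
  left_finite V f -> right_finite C f.
Proof.
move=> Cf V1 cC fV.
pose VV := [set v : G | V (v^-1)%g].
have V1V : nbhs 1%g VV.
  by move: V1; rewrite -{1}(invg1 G); exact: invg_continuous.
have fV' : right_finite VV (fun p => f (p^-1)%g).
  by apply: right_finite_inv fV => w.
have : left_finite [set (p^-1)%g | p in C] (fun p => f (p^-1)%g).
  by apply: (right_left_finite (Cc_inv hG Cf) V1V _ fV'); exact: compact_invg.
move=> /(right_finite_inv (W := C)) CC.
apply: (eq_finite_rank _ (CC _)) => [p v _ _|w Cw]; first by rewrite invgK.
by exists w.
Qed.

(** The coefficients are combinations of the functions [v |-> f (x i * v)], hence
    continuous. This regularity is the reason to go through a skeleton. *)
Lemma right_finite_expansion V f : continuous f -> right_finite V f ->
  exists d (y : 'I_d -> G) (c : 'I_d -> G -> R[i]),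
    (forall j, continuous (c j)) /\
    forall p v, V v -> f (p * v)%g = \sum_j c j v * f (p * y j)%g.
Proof.
move=> cf /finite_rank_skeleton[d [x [y [N [_ _ fE]]]]].
exists d, y, (fun j v => \sum_i N j i * f (x i * v)%g); split=> [j|p v Vv].
  apply: continuous_sum => i; apply: continuousZ_complex.
  exact: (continuous_fun_comp (@continuous_mulgl G (x i)) cf).
rewrite [LHS]fE //; apply: eq_bigr => j _; rewrite mulrC mulr_sumr.
by apply: eq_bigr => i _; rewrite mulrA.
Qed.

Lemma left_finite_expansion V f : continuous f -> left_finite V f ->
  exists d (y : 'I_d -> G) (c : 'I_d -> G -> R[i]),
    (forall j, continuous (c j)) /\
    forall v p, V v -> f (v * p)%g = \sum_j c j v * f (y j * p)%g.
Proof.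
move=> cf /finite_rank_skeleton[d [x [y [N [_ _ fE]]]]].
exists d, x, (fun i v => \sum_j N j i * f (v * y j)%g); split=> [i|v p Vv].
  apply: continuous_sum => j; apply: continuousZ_complex.
  exact: (continuous_fun_comp (@continuous_mulgr G (y j)) cf).
rewrite [LHS]fE // exchange_big; apply: eq_bigr => i _; rewrite mulr_suml.
by apply: eq_bigr => j _; rewrite (mulrC (N j i)).
Qed.

(** A function whose translates by small elements have coordinates that vary
    continuously is itself continuous, being near [p] a combination of the
    translates of the coordinates. *)
Lemma right_expansion_continuous V f d (y : 'I_d -> G) (c : 'I_d -> G -> R[i]) :
  nbhs 1%g V -> (forall j, continuous (c j)) ->
  (forall p v, V v -> f (p * v)%g = \sum_j c j v * f (p * y j)%g) ->
  continuous f.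
Proof.
move=> V1 cc fE p.
have fE' z : [set (p * q)%g | q in V] z ->
    f z = \sum_j f (p * y j)%g * c j (p^-1 * z)%g.
  move=> [v Vv <-]; rewrite fE // mulKg.
  by apply: eq_bigr => j _; rewrite mulrC.
have pV : nbhs p [set (p * q)%g | q in V].
  by rewrite -[X in nbhs X]mulg1; exact: nbhs_translate.
apply: (@continuous_near_eq _ _ p f
  (fun z => \sum_j f (p * y j)%g * c j (p^-1 * z)%g)).
- by apply: fE'; exact: nbhs_singleton.
- exact: filterS fE' pV.
- apply: continuous_sum => j; apply: continuousZ_complex.
  exact: (continuous_fun_comp (@continuous_mulgl G p^-1%g) (cc j)).
Qed.

Lemma left_expansion_continuous V f d (y : 'I_d -> G) (c : 'I_d -> G -> R[i]) :
  nbhs 1%g V -> (forall j, continuous (c j)) ->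
  (forall v p, V v -> f (v * p)%g = \sum_j c j v * f (y j * p)%g) ->
  continuous f.
Proof.
move=> V1 cc fE p.
pose pV := [set z | V (z * p^-1)%g].
have fE' z : pV z -> f z = \sum_j f (y j * p)%g * c j (z * p^-1)%g.
  move=> Vz; rewrite -[in LHS](mulgVK p z) fE //.
  by apply: eq_bigr => j _; rewrite mulrC.
have npV : nbhs p pV.
  have := @continuous_mulgr G p^-1%g p; rewrite /continuous_at mulgV.
  by move=> /(_ V V1).
apply: (@continuous_near_eq _ _ p f
  (fun z => \sum_j f (y j * p)%g * c j (z * p^-1)%g)).
- by apply: fE'; exact: nbhs_singleton.
- exact: filterS fE' npV.
- apply: continuous_sum => j; apply: continuousZ_complex.
  exact: (continuous_fun_comp (@continuous_mulgr G p^-1%g) (cc j)).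
Qed.

Lemma submod_closed_span (K : nzRingType) (L : lmodType K) n (e : 'I_n -> L) :
  submod_closed [in linear_span e].
Proof.
split=> [|a u v]; rewrite !inE.
  by exists (fun=> 0) => //; rewrite big1 // => i _; rewrite scale0r.
move=> [c _ <-] [d _ <-]; exists (fun i => a * c i + d i) => //.
rewrite scaler_sumr -big_split; apply: eq_bigr => i _.
by rewrite scalerDl scalerA.
Qed.

Lemma span_Cc n (e : 'I_n -> G -> R[i]) : (forall i, Cc R G (e i)) ->
  subspace_of (Cc R G) (linear_span e).
Proof.
move=> Ce; split; last exact: submod_closed_span.
move=> _ [c _ <-]; have := Cc_sum hG c Ce; congr (Cc _ _ _).
by apply/funext => p; rewrite fct_sumE.
Qed.

(** A bound on the dimension of the span of the translates of [f] by [V] amounts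
    to a finite rank of [(p, v) |-> f (p * v)]; conversely the expansion of the
    kernel displays finitely many translates of [f] that span the others. *)
Lemma polynomialP f : polynomial_fun R G f <->
  Cc R G f /\ exists2 V, nbhs 1%g V & right_finite V f.
Proof.
split=> [[Cf [V [F [oV _ [n [e ->]] FV]]]]|[Cf [V V1 fV]]]; split=> //.
  exists V; first exact: open_nbhs_nbhs.
  have /choice[c cE] v : exists c : 'I_n -> R[i], V v ->
      translate v f = \sum_i c i *: e i.
    have [/FV[c _ <-]|nVv] := pselect (V v); last by exists (fun=> 0).
    by exists c.
  exists n, (fun p => \row_i e i p), (fun v => \col_i c v i) => p v _ Vv.
  rewrite -[LHS]/(translate v f p) cE // fct_sumE mxE.
  by apply: eq_bigr => i _; rewrite !mxE mulrC.
have [d [y [c [_ fE]]]] := right_finite_expansion (Cc_continuous Cf) fV.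
exists V°, (linear_span (fun j => translate (y j) f)); split.
- by split; [exact: open_interior|exact: V1].
- by apply: span_Cc => j; exact: Cc_translate.
- by exists d, (fun j => translate (y j) f).
move=> v /interior_subset Vv; exists (c^~ v) => //.
by apply/funext => p; rewrite fct_sumE [RHS]fE.
Qed.

Variable H : set G.
Hypotheses (cH : compact H) (H1 : nbhs 1%g H).

Lemma polynomial_rightP f : polynomial_fun R G f <->
  Cc R G f /\ right_finite H f.
Proof.
rewrite polynomialP; split=> -[Cf].
  by move=> [V V1 fV]; split=> //; apply: (left_right_finite _ H1) => //;
    exact: right_left_finite fV.
by move=> fH; split=> //; exists H.
Qed.

Lemma polynomial_leftP f : polynomial_fun R G f <->
  Cc R G f /\ left_finite H f.
Proof.
rewrite polynomial_rightP; split=> -[Cf fH]; split=> //.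
  exact: right_left_finite fH.
exact: left_right_finite fH.
Qed.

End one_sided_finiteness.

(** * Integration of test functions against a Haar measure *)

Section Borel.
Context {R : realType} {G : topologicalGroupType}.

Lemma open_Borel (U : set G) : open U -> measurable (U : set (Borel G)).
Proof. by move=> oU; exact: sub_sigma_algebra. Qed.

Lemma closed_Borel (U : set G) : closed U -> measurable (U : set (Borel G)).
Proof.
by move=> /closed_openC/open_Borel/measurableC; rewrite setCK.
Qed.

Lemma continuous_Borel_real (h : G -> R) : continuous h ->
  measurable_fun [set: Borel G] (h : Borel G -> R).
Proof.
move=> /continuousP ch; apply: (measurability _ (RGenOpens.measurableE R)).
move=> _ [_ [a [b ->] <-]]; rewrite setTI; apply: open_Borel.
exact/ch/interval_open.
Qed.

Lemma continuous_Borel (h : G -> G) : continuous h ->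
  measurable_fun [set: Borel G] (h : Borel G -> Borel G).
Proof.
move=> /continuousP ch; apply: (@measurability _ _ (Borel G) (Borel G) _ _ (@open G) erefl).
by move=> _ [U oU <-]; rewrite setTI; apply: open_Borel; exact: ch.
Qed.

End Borel.

Section Haar.
Local Open Scope complex_scope.
Context {R : realType} {G : topologicalGroupType}.
Hypothesis hG : hausdorff_space G.
Variable mu : {measure set (Borel G) -> \bar R}.
Hypothesis haar : left_haar_measure mu.
Implicit Types (f g : G -> R[i]) (p q : G).

Lemma integrable_compact_support (h : G -> R) (C : set G) : continuous h ->
  compact C -> (forall p, h p != 0 -> C p) ->
  mu.-integrable [set: Borel G] (EFin \o (h : Borel G -> R)).
Proof.
move=> ch cC hC; have [_ _ muK _ _] := haar.
have mC : measurable (C : set (Borel G)).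
  by apply: closed_Borel; exact: compact_closed.
have -> : EFin \o (h : Borel G -> R) = (EFin \o (h : Borel G -> R)) \_ C.
  apply/funext => x; rewrite patchE; case: ifPn => // /negP xC.
  congr EFin; apply/eqP; apply: contra_notT xC => /hC Cx.
  by rewrite inE.
apply: (integrable_mkcond _ mC).1; apply: measurable_bounded_integrable => //.
- exact: muK.
- by apply: measurable_funTS; exact: continuous_Borel_real.
- have /compact_bounded[M [_ Mh]] : compact (h @` C).
    by apply: continuous_compact => //; exact: continuous_subspaceT.
  exists M; split; first exact: num_real.
  by move=> x Mx y Cy; apply: Mh => //; exists y.
Qed.

Lemma integrable_Re f : Cc R G f ->
  mu.-integrable [set: Borel G] (EFin \o (fun q : Borel G => complex.Re (f q))).
Proof.
move=> /(CcP hG)[cf [C cC fC]].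
apply: integrable_compact_support cC _; first exact: continuous_fun_comp cf continuous_Re.
by move=> p; apply: contraNP => nC; apply/eqP; have [->//|/fC] := eqVneq (f p) 0.
Qed.

Lemma integrable_Im f : Cc R G f ->
  mu.-integrable [set: Borel G] (EFin \o (fun q : Borel G => complex.Im (f q))).
Proof.
move=> /(CcP hG)[cf [C cC fC]].
apply: integrable_compact_support cC _; first exact: continuous_fun_comp cf continuous_Im.
by move=> p; apply: contraNP => nC; apply/eqP; have [->//|/fC] := eqVneq (f p) 0.
Qed.

Lemma cintegral0 : cintegral mu (fun=> 0) = 0.
Proof. by rewrite /cintegral /Rintegral /= integral0. Qed.

Lemma cintegralD f g : Cc R G f -> Cc R G g ->
  cintegral mu (fun q => f q + g q) = cintegral mu f + cintegral mu g.
Proof.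
move=> Cf Cg.
apply/eqP; rewrite eq_complex /=; apply/andP; split; apply/eqP.
  have <- := RintegralD measurableT (integrable_Re Cf) (integrable_Re Cg).
  by apply: eq_Rintegral => q _; case: (f q) (g q) => [? ?] [? ?].
have <- := RintegralD measurableT (integrable_Im Cf) (integrable_Im Cg).
by apply: eq_Rintegral => q _; case: (f q) (g q) => [? ?] [? ?].
Qed.

Lemma cintegralZ c f : Cc R G f ->
  cintegral mu (fun q => c * f q) = c * cintegral mu f.
Proof.
move=> Cf; have [fRe fIm] := (integrable_Re Cf, integrable_Im Cf).
have scale a h : mu.-integrable [set: Borel G] (EFin \o h) ->
    mu.-integrable [set: Borel G] (EFin \o (fun q => a * h q)).
  by move=> /(integrableZl measurableT a).
apply/eqP; rewrite eq_complex; case: c => a b /=; apply/andP; split; apply/eqP.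
  rewrite -!RintegralZl // -RintegralB //; [|exact: scale..].
  by apply: eq_Rintegral => q _; case: (f q).
rewrite -!RintegralZl // -RintegralD //; [|exact: scale..].
by apply: eq_Rintegral => q _; case: (f q).
Qed.

Lemma cintegral_sum n (c : 'I_n -> R[i]) (e : 'I_n -> G -> R[i]) :
  (forall i, Cc R G (e i)) ->
  cintegral mu (fun q => \sum_i c i * e i q) = \sum_i c i * cintegral mu (e i).
Proof.
move=> Ce; suff H s : Cc R G (fun q => \sum_(i <- s) c i * e i q) /\
    cintegral mu (fun q => \sum_(i <- s) c i * e i q) =
      \sum_(i <- s) c i * cintegral mu (e i) by have [] := H (index_enum _).
elim: s => [|i s [IHC IHs]].
  under eq_fun do rewrite big_nil.
  by rewrite big_nil cintegral0; split=> //; exact: Cc0.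
under eq_fun do rewrite big_cons.
have Cei : Cc R G (fun q => c i * e i q).
  by under eq_fun do rewrite mulrC; apply: Cc_mul => // q; exact: cvg_cst.
split; first exact: Cc_add.
by rewrite cintegralD // IHs cintegralZ // big_cons.
Qed.

Lemma haar_translate p (A : set (Borel G)) : measurable A ->
  mu ((fun q => p * q)%g @^-1` A) = mu A.
Proof.
move=> mA; have [_ muL _ _ _] := haar; rewrite -(muL p^-1%g A mA).
congr (mu _); apply/seteqP; split=> [q /= Apq|_ [q Aq <-]] /=.
  by exists (p * q)%g; rewrite // mulKg.
by rewrite mulVKg.
Qed.

Lemma Rintegral_translate p (h : Borel G -> R) :
  mu.-integrable [set: Borel G] (EFin \o h) ->
  measurable_fun [set: Borel G] h ->
  mu.-integrable [set: Borel G] (EFin \o (fun q => h (p * q)%g)) ->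
  \int[mu]_q h (p * q)%g = \int[mu]_q h q.
Proof.
move=> ih mh ihp; rewrite /Rintegral; congr fine.
have mp : measurable_fun [set: Borel G] (fun q : Borel G => (p * q)%g : Borel G).
  by apply: continuous_Borel; exact: continuous_mulgl.
have := @integral_pushforward _ _ (Borel G) (Borel G) R _ mp mu setT (EFin \o h).
rewrite preimage_setT => /(_ _ ihp measurableT) <-; last exact/measurable_EFinP.
by apply: eq_measure_integral => A mA _; exact: haar_translate.
Qed.

Lemma cintegral_translate p f : Cc R G f ->
  cintegral mu (fun q => f (p * q)%g) = cintegral mu f.
Proof.
move=> Cf; have Cpf := Cc_mulgl hG p Cf.
rewrite /cintegral; congr (_ +i* _).
  apply: (Rintegral_translate (h := fun q => complex.Re (f q))).
  - exact: integrable_Re.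
  - apply: continuous_Borel_real.
    exact: continuous_fun_comp (Cc_continuous Cf) continuous_Re.
  - exact: integrable_Re.
apply: (Rintegral_translate (h := fun q => complex.Im (f q))).
- exact: integrable_Im.
- apply: continuous_Borel_real.
  exact: continuous_fun_comp (Cc_continuous Cf) continuous_Im.
- exact: integrable_Im.
Qed.

(** If a nonempty open set were null, so would be its translates, which cover every
    compact set by finitely many; inner regularity would make the group null. *)
Lemma haar_open_neq0 (U : set G) : open U -> U !=set0 -> mu U != 0%E.
Proof.
move=> oU [u Uu]; have [mu0 muL _ _ mui] := haar.
apply: contra mu0 => /eqP muU0.
have transl p : mu [set (p * q)%g | q in U] = 0%E by rewrite muL //; exact: open_Borel.
have muK0 (K : set G) : compact K -> mu K = 0%E.
  move=> cK; have mK : measurable (K : set (Borel G)).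
    by apply: closed_Borel; exact: compact_closed.
  suff [N [mN muN KN]] : mu.-negligible (K : set (Borel G)).
    exact: (subset_measure0 mK mN KN muN).
  apply: (@compact_ideal_ind G (fun A => mu.-negligible (A : set (Borel G)))) => //.
  - exact: negligible_set0.
  - by move=> A B AB; exact: negligibleS.
  - by move=> A B; exact: negligibleU.
  - move=> s _; exists [set (s * u^-1 * q)%g | q in U].
      rewrite -[X in nbhs X](mulgVK u); apply: nbhs_translate.
      exact: open_nbhs_nbhs.
    apply/negligibleP; last exact: transl.
    by apply: open_Borel; exact: open_translate.
rewrite (mui setT openT) eq_le; apply/andP; split; last first.
  by apply: ereal_sup_ubound; exists set0; [split=> //; exact: compact0|rewrite measure0].
by apply: ge_ereal_sup => _ [K [/muK0 + _] <-] => ->.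
Qed.

(** The inner product of test functions is definite, because a nonzero continuous
    function is nonzero on a nonempty open set. *)
Lemma cintegral_norm_eq0 f : Cc R G f ->
  cintegral mu (fun q => f q * conjc (f q)) = 0 -> f = (fun=> 0).
Proof.
move=> Cf [+ _]; set h := fun q => complex.Re _ => h0.
have CF := Cc_mul hG Cf (Cc_continuous (Cc_conj hG Cf)).
have ch : continuous h := continuous_fun_comp (Cc_continuous CF) continuous_Re.
have h_ge0 q : 0 <= h q.
  by rewrite /h; have := mulcJ_ge0 (f q); rewrite lecE => /andP[].
have fh q : h q = 0 -> f q = 0.
  rewrite /h => fq; apply/eqP; rewrite -normr_eq0 -sqrf_eq0 sqr_normc eq_complex fq eqxx.
  by have := mulcJ_ge0 (f q); rewrite lecE eq_sym => /andP[].
have oU : open [set q | h q != 0].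
  move/continuousP : ch => /(_ [set x | x != 0]); apply; exact: open_neq.
have ih : mu.-integrable [set: Borel G] (EFin \o h) by exact: integrable_Re.
have : (\int[mu]_q `|(EFin \o h) q| = 0)%E.
  under eq_integral do rewrite /= ger0_norm //.
  rewrite -[LHS]fineK; first by rewrite -[fine _]/(\int[mu]_q h q) h0.
  exact: (integrable_fin_num measurableT ih).
move/(ae_eq_integral_abs mu measurableT).
move=> /(_ (measurable_int _ ih)) [N [mN muN hN]].
apply/funext => q; apply: fh; apply/eqP.
apply: contrapT => /negP hq.
have /eqP := haar_open_neq0 oU (ex_intro _ q hq); apply.
apply: (subset_measure0 _ mN) => //; first exact: open_Borel.
move=> x /= hx; apply: hN => /= /(_ I) [hx0].
by rewrite hx0 eqxx in hx.
Qed.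

End Haar.

(** * Convolution *)

Section convolution.
Context {R : realType} {G : topologicalGroupType}.
Hypothesis hG : hausdorff_space G.
Variable mu : {measure set (Borel G) -> \bar R}.
Hypothesis haar : left_haar_measure mu.
Implicit Types (f g : G -> R[i]) (p q : G) (V : set G).

Lemma Cc_convolution_integrand f g p : Cc R G f -> continuous g ->
  Cc R G (fun q => f q * g (q^-1 * p)%g).
Proof.
move=> Cf cg.
have cq : continuous (fun q => (q^-1 * p)%g).
  exact: (continuous_fun_comp (@invg_continuous G) (@continuous_mulgr G p)).
exact: (Cc_mul hG Cf (continuous_fun_comp cq cg)).
Qed.

Lemma convolution_support f g : Cc R G f -> Cc R G g ->
  exists2 C, compact C & forall p, convolution mu f g p != 0 -> C p.
Proof.
move=> /(CcP hG)[_ [C cC fC]] /(CcP hG)[_ [D cD gD]].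
exists [set (x.1 * x.2)%g | x in C `*` D]; first exact: compact_mulg.
move=> p fgp; apply: contrapT => nCDp; move/eqP: fgp; apply.
rewrite /convolution -[RHS](cintegral0 mu); congr cintegral; apply/funext => q.
apply/eqP; apply: contraT; rewrite mulf_eq0 negb_or => /andP[/fC Cq /gD Dq].
by case: nCDp; exists (q, q^-1 * p)%g; rewrite //= mulVKg.
Qed.

Lemma convolution_right_expansion V f g d (y : 'I_d -> G)
    (c : 'I_d -> G -> R[i]) : Cc R G f -> Cc R G g ->
  (forall p v, V v -> g (p * v)%g = \sum_j c j v * g (p * y j)%g) ->
  forall p v, V v -> convolution mu f g (p * v)%g =
    \sum_j c j v * convolution mu f g (p * y j)%g.
Proof.
move=> Cf Cg gE p v Vv; rewrite -cintegral_sum //; last first.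
  by move=> j; apply: Cc_convolution_integrand => //; exact: Cc_continuous.
congr cintegral; apply/funext => q; rewrite mulgA gE // mulr_sumr.
by apply: eq_bigr => j _; rewrite mulrCA mulgA.
Qed.

(** By left invariance of the measure, translating a convolution on the left
    amounts to translating its first factor. *)
Lemma convolution_left_expansion V f g d (y : 'I_d -> G)
    (c : 'I_d -> G -> R[i]) : Cc R G f -> Cc R G g ->
  (forall v p, V v -> f (v * p)%g = \sum_j c j v * f (y j * p)%g) ->
  forall v p, V v -> convolution mu f g (v * p)%g =
    \sum_j c j v * convolution mu f g (y j * p)%g.
Proof.
move=> Cf Cg fE v p Vv.
have transl w : convolution mu f g (w * p)%g =
    cintegral mu (fun q => f (w * q)%g * g (q^-1 * p)%g).
  rewrite -[LHS](cintegral_translate hG haar w); last first.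
    by apply: Cc_convolution_integrand => //; exact: Cc_continuous.
  congr cintegral; apply/funext => q; congr (_ * g _).
  by rewrite invgM -mulgA mulKg.
rewrite transl; under eq_bigr do rewrite transl.
rewrite -cintegral_sum //; last first.
  move=> j; apply: (Cc_convolution_integrand p (Cc_mulgl hG (y j) Cf)).
  exact: Cc_continuous.
congr cintegral; apply/funext => q; rewrite fE // mulr_suml.
by apply: eq_bigr => j _; rewrite mulrA.
Qed.

(** Translating a convolution on the right only moves its second factor, so an
    expansion of the translates of [g] is inherited by those of the convolution,
    with the same coefficients; these being continuous, the convolution is
    continuous too. *)
Lemma convolution_right_finite V f g : nbhs 1%g V -> Cc R G f -> Cc R G g ->
  right_finite V g ->
  Cc R G (convolution mu f g) /\ right_finite V (convolution mu f g).
Proof.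
move=> V1 Cf Cg /(right_finite_expansion (Cc_continuous Cg))[d [y [c [cc gE]]]].
have fgE := convolution_right_expansion Cf Cg gE; split.
  apply/(CcP hG); split; last exact: convolution_support.
  exact: right_expansion_continuous V1 cc fgE.
exists d, (fun p => \row_j convolution mu f g (p * y j)%g), (fun v => \col_j c j v).
move=> p v _ Vv; rewrite fgE // mxE.
by apply: eq_bigr => j _; rewrite !mxE mulrC.
Qed.

Lemma convolution_left_finite V f g : nbhs 1%g V -> Cc R G f -> Cc R G g ->
  left_finite V f ->
  Cc R G (convolution mu f g) /\ left_finite V (convolution mu f g).
Proof.
move=> V1 Cf Cg /(left_finite_expansion (Cc_continuous Cf))[d [y [c [cc fE]]]].
have fgE := convolution_left_expansion Cf Cg fE; split.
  apply/(CcP hG); split; last exact: convolution_support.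
  exact: left_expansion_continuous V1 cc fgE.
exists d, (fun v => \row_j c j v), (fun p => \col_j convolution mu f g (y j * p)%g).
move=> v p Vv _; rewrite fgE // mxE.
by apply: eq_bigr => j _; rewrite !mxE.
Qed.

(** On the finite-dimensional space spanned by the [e i], evaluation at [p] is the
    inner product with some member of this space. In terms of the Gram matrix
    [M], solving for that member requires the row of the [e i p] to vanish on
    the kernel of [M]; but a vector of that kernel gives a combination of the
    [e i] which is orthogonal to itself, hence the zero function. *)
Lemma Riesz_evaluation n (e : 'I_n -> G -> R[i]) (p : G) :
  (forall i, Cc R G (e i)) ->
  exists c : 'I_n -> R[i], forall i,
    cintegral mu (fun q => e i q * conjc (\sum_j c j * e j q)) = e i p.
Proof.
move=> Ce.
have Cee f j : Cc R G f -> Cc R G (fun q => f q * conjc (e j q)).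
  by move=> Cf; apply: Cc_mul => //; exact/Cc_continuous/Cc_conj.
have int_conj f (c : 'I_n -> R[i]) : Cc R G f ->
    cintegral mu (fun q => f q * conjc (\sum_j c j * e j q)) =
    \sum_j conjc (c j) * cintegral mu (fun q => f q * conjc (e j q)).
  move=> Cf; rewrite -cintegral_sum //; last by move=> j; exact: Cee.
  congr cintegral; apply/funext => q; rewrite rmorph_sum mulr_sumr.
  by apply: eq_bigr => j _; rewrite rmorphM mulrCA.
pose M := \matrix_(j, i) cintegral mu (fun q => e i q * conjc (e j q)).
pose ev := \row_i e i p.
have /submxP[z zE] : (ev <= M)%MS.
  rewrite submxE; apply/eqP/matrixP => i0 k; rewrite ord1 [RHS]mxE.
  pose x i := cokermx M i k; pose u q := \sum_i x i * e i q.
  have Cu : Cc R G u by exact: Cc_sum.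
  have u_orth j : cintegral mu (fun q => u q * conjc (e j q)) = 0.
    have := mulmx_coker M => /matrixP/(_ j k); rewrite [RHS]mxE => <-.
    rewrite mxE; under eq_bigr do rewrite mxE mulrC.
    rewrite -cintegral_sum //; last by move=> i; exact: Cee.
    congr cintegral; apply/funext => q; rewrite mulr_suml.
    by apply: eq_bigr => i _; rewrite mulrA.
  have u0 : u = (fun=> 0).
    apply: (cintegral_norm_eq0 hG haar Cu).
    by rewrite [LHS]int_conj // big1 // => j _; rewrite u_orth mulr0.
  rewrite mxE -[RHS](congr1 (@^~ p) u0); apply: eq_bigr => i _.
  by rewrite mxE mulrC.
exists (fun j => conjc (z 0 j)) => i; rewrite int_conj //.
have /matrixP/(_ 0 i) := zE; rewrite !mxE => ->.
by apply: eq_bigr => j _; rewrite conjcK mxE.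
Qed.

End convolution.

(** * The algebra of polynomial functions *)

Section polynomial_functions.
Local Open Scope complex_scope.
Context {R : realType} {G : topologicalGroupType}.
Hypothesis hG : hausdorff_space G.
Variable H : set G.
Hypotheses (sgH : is_subgroup H) (cH : compact H) (oH : open H).
Implicit Types (f g : G -> R[i]) (p q : G).

Let memH1 : H 1%g. Proof. by have [+ _] := sgH; rewrite inE. Qed.

Let nbhsH : nbhs 1%g H.
Proof. exact: open_nbhs_nbhs (conj oH memH1). Qed.

Let memHV p : H p -> H (p^-1)%g.
Proof. by move=> Hp; have := group_closedV sgH; move/(_ p); rewrite !inE; apply. Qed.

Let memHM p q : H p -> H q -> H (p * q)%g.
Proof.
by move=> Hp Hq; have := group_closedM sgH; move/(_ p q); rewrite !inE; apply.
Qed.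

Let polyP f := polynomial_rightP hG cH nbhsH f.

Lemma polynomial_linear (a : R[i]) f g : polynomial_fun R G f ->
  polynomial_fun R G g -> polynomial_fun R G (fun p => a * f p + g p).
Proof.
move=> /polyP[Cf fH] /polyP[Cg gH]; apply/polyP; split.
  apply: (Cc_add hG _ Cg); under eq_fun do rewrite mulrC.
  by apply: (Cc_mul hG Cf) => q; exact: cvg_cst.
apply: finite_rankD gH.
apply: eq_finite_rank (finite_rankM (fun=> a) (fun=> 1) fH) => p v _ _.
by rewrite mulr1.
Qed.

Lemma polynomial0 : polynomial_fun R G (fun=> 0).
Proof.
apply/polyP; split; first exact: Cc0.
apply: eq_finite_rank (finite_rank1 _ _ (fun=> 0) (fun=> 0)) => p v _ _.
by rewrite mulr0.
Qed.

Lemma polynomial_sum n (c : 'I_n -> R[i]) (e : 'I_n -> G -> R[i]) :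
  (forall i, polynomial_fun R G (e i)) ->
  polynomial_fun R G (fun p => \sum_i c i * e i p).
Proof.
move=> Pe; suff L s : polynomial_fun R G (fun p => \sum_(i <- s) c i * e i p) by [].
elim: s => [|i s IHs].
  by under eq_fun do rewrite big_nil; exact: polynomial0.
by under eq_fun do rewrite big_cons; exact: polynomial_linear.
Qed.

Lemma polynomial_subspace : subspace_of (Cc R G) (polynomial_fun R G).
Proof.
split=> [f /polyP[]//|]; split=> [|a f g]; rewrite !inE.
  exact: polynomial0.
exact: polynomial_linear.
Qed.

Lemma polynomial_conj f : polynomial_fun R G f ->
  polynomial_fun R G (fun p => conjc (f p)).
Proof.
move=> /polyP[Cf fH]; apply/polyP; split; first exact: Cc_conj.
exact: (finite_rank_map (@conjc R) fH).
Qed.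

Lemma polynomial_mulgl p f : polynomial_fun R G f ->
  polynomial_fun R G (fun q => f (p * q)%g).
Proof.
move=> /polyP[Cf fH]; apply/polyP; split; first exact: Cc_mulgl.
apply: (eq_finite_rank _ (finite_rank_comp (f := fun q => (p * q)%g) (g := id)
  _ _ fH)) => // q v _ _.
by rewrite mulgA.
Qed.

Lemma polynomial_mulgr p f : polynomial_fun R G f ->
  polynomial_fun R G (fun q => f (q * p)%g).
Proof.
move=> /(polynomial_leftP hG cH nbhsH)[Cf fH].
apply/(polynomial_leftP hG cH nbhsH); split; first exact: (Cc_translate hG p Cf).
apply: (eq_finite_rank _ (finite_rank_comp (f := id) (g := fun q => (q * p)%g)
  _ _ fH)) => // v q _ _.
by rewrite mulgA.
Qed.

(** Inversion exchanges left and right finiteness, which are equivalent. *)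
Lemma polynomial_inv (chi : G -> R[i]) f : continuous chi ->
  {morph chi : p q / (p * q)%g >-> p * q} -> polynomial_fun R G f ->
  polynomial_fun R G (fun p => chi p * f (p^-1)%g).
Proof.
move=> cchi chiM /(polynomial_leftP hG cH nbhsH)[Cf fH].
apply/polyP; split.
  under eq_fun do rewrite mulrC.
  exact: (Cc_mul hG (Cc_inv hG Cf) cchi).
have fVH := right_finite_inv memHV fH.
apply: eq_finite_rank (finite_rankM chi chi fVH) => p v _ _.
by rewrite chiM.
Qed.

Definition indic p : R[i] := (p \in H)%:R.

Lemma continuous_indic : continuous indic.
Proof.
move=> p; have [Hp|nHp] := pselect (H p).
  apply: (@continuous_near_eq _ _ p indic (fun=> 1)).
  - by rewrite /indic mem_set.
  - have : nbhs p H by exact: open_nbhs_nbhs.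
    by apply: filterS => q Hq; rewrite /indic mem_set.
  - exact: cst_continuous.
apply: (@continuous_near_eq _ _ p indic (fun=> 0)).
- by rewrite /indic memNset.
- have : nbhs p (~` H).
    by apply: open_nbhs_nbhs; split=> //; apply: closed_openC; exact: compact_closed.
  by apply: filterS => q nHq; rewrite /indic memNset.
- exact: cst_continuous.
Qed.

Lemma Cc_indic (chi : G -> R[i]) :
  continuous chi -> Cc R G (fun p => indic p * chi p).
Proof.
move=> cchi; apply: (Cc_mul hG _ cchi).
apply/(CcP hG); split; first exact: continuous_indic.
exists H => // p; apply: contra_neqP => nHp.
by rewrite /indic memNset.
Qed.

(** Multiplication by the indicator of [H] commutes with right translation by
    elements of [H], as [H] is a subgroup. *)
Lemma polynomial_indic f : polynomial_fun R G f ->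
  polynomial_fun R G (fun p => indic p * f p).
Proof.
move=> /polyP[Cf fH]; apply/polyP; split.
  by apply: Cc_indic; exact: Cc_continuous.
apply: eq_finite_rank (finite_rankM indic (fun=> 1) fH) => p v _ Hv.
rewrite mulr1 /indic; congr ((_ : bool)%:R * _).
apply/idP/idP; rewrite !inE => Hp; first exact: memHM.
by rewrite -(mulgK v p); apply: memHM => //; exact: memHV.
Qed.

Variable mu : {measure set (Borel G) -> \bar R}.
Hypothesis haar : left_haar_measure mu.

Lemma polynomial_convolution f g : Cc R G f -> Cc R G g ->
  polynomial_fun R G f \/ polynomial_fun R G g ->
  polynomial_fun R G (convolution mu f g).
Proof.
move=> Cf Cg [/(polynomial_leftP hG cH nbhsH)[_ fH]|/polyP[_ gH]].
  apply/(polynomial_leftP hG cH nbhsH).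
  exact: (convolution_left_finite hG haar nbhsH Cf Cg fH).
apply/polyP; exact: (convolution_right_finite hG haar nbhsH Cf Cg gH).
Qed.

Variable delta : G -> R.
Hypothesis modular : modular_function mu delta.

Definition inv_delta p : R[i] := ((delta p)^-1)%:C.

Lemma continuous_inv_delta : continuous inv_delta.
Proof.
have [cd d0 _ _] := modular.
have cdV : continuous (fun p => (delta p)^-1).
  by move=> p; apply: cvgV; [rewrite gt_eqF|exact: cd].
exact: (continuous_fun_comp cdV continuous_real_complex).
Qed.

Lemma inv_deltaM : {morph inv_delta : p q / (p * q)%g >-> p * q}.
Proof.
have [_ _ dM _] := modular.
by move=> p q; rewrite /inv_delta dM invfM rmorphM.
Qed.

Lemma inv_delta1 : inv_delta 1%g = 1.
Proof.
have [_ d0 dM _] := modular.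
have := dM 1%g 1%g; rewrite mulg1 => /(congr1 (fun x => (delta 1%g)^-1 * x)).
by rewrite mulKf ?mulVf ?gt_eqF // /inv_delta => <-; rewrite invr1.
Qed.

Lemma polynomial_involution f : polynomial_fun R G f ->
  polynomial_fun R G (involution delta f).
Proof.
move=> /polynomial_conj Pf.
exact: (polynomial_inv continuous_inv_delta inv_deltaM Pf).
Qed.

(** Substitute [p * q] and then [q^-1] for the variable of integration. The result
    exhibits right convolution by [g] as the integral of [g] against a kernel,
    like left convolution. *)
Lemma convolution_reflect f g p : Cc R G f -> Cc R G g ->
  convolution mu f g p =
  cintegral mu (fun q => inv_delta q * f (p * q^-1)%g * g q).
Proof.
move=> Cf Cg; have [_ _ _ mod] := modular.
have CF : Cc R G (fun q => f q * g (q^-1 * p)%g).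
  by apply: Cc_convolution_integrand => //; exact: Cc_continuous.
rewrite /convolution -(cintegral_translate hG haar p CF).
rewrite -(mod _ (Cc_mulgl hG p CF)).
congr cintegral; apply/funext => q; rewrite mulrC mulrA; congr (_ * _ * g _).
by rewrite invgM invgK mulgVK.
Qed.

Lemma finite_rank_indic (X : Type) (A : set X) (k : X -> G -> R[i]) :
  finite_rank A H k -> finite_rank A setT (fun x q => indic q * k x q).
Proof.
move=> kH; rewrite -(setUv H); apply: finite_rankU.
  apply: eq_finite_rank (finite_rankM (fun=> 1) indic kH) => x q _ _.
  by rewrite mul1r.
apply: eq_finite_rank (finite_rank1 _ _ (fun=> 0) (fun=> 0)) => x q _ nHq.
by rewrite /indic memNset // !mul0r.
Qed.

(** The functions against which [u] must integrate to their value at the identity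
    in order to be a unit for all the [a i]: for [u] supported in [H], the
    integral of [u] against [unit_kernel a (i, true, p)] is the value at [p] of
    the convolution of [u] with [a i], and [unit_kernel a (i, false, p)] does
    the same for the convolution of [a i] with [u]. *)
Definition unit_kernel n (a : 'I_n -> G -> R[i]) (x : ('I_n * bool) * G) q :=
  indic q * (if x.1.2 then a x.1.1 (q^-1 * x.2)%g
             else inv_delta q * a x.1.1 (x.2 * q^-1)%g).

(** This is where the compactness of [H] is essential: a polynomial function spans
    finitely many dimensions under translation by all of [H], not only by a
    small neighborhood of the identity. *)
Lemma unit_kernel_finite_rank n (a : 'I_n -> G -> R[i]) :
  (forall i, polynomial_fun R G (a i)) ->
  finite_rank setT setT (unit_kernel a).
Proof.
move=> Pa.
pose k (y : 'I_n * bool) (x : 'I_n * bool * G) q :=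
  (x.1 == y)%:R * 1 * unit_kernel a (y, x.2) q.
have kP y : finite_rank setT setT (k y).
  apply: finite_rankM; apply: finite_rank_indic; case: y => i [] /=.
    have /(polynomial_leftP hG cH nbhsH)[_ /finite_rank_tr aH] := Pa i.
    exact: (finite_rank_comp (f := fun x : 'I_n * bool * G => x.2)
      (g := fun q => (q^-1)%g) _ memHV aH).
  have /polyP[_ aH] := Pa i.
  have aH' : finite_rank [set: 'I_n * bool * G] H (fun x q => a i (x.2 * q^-1)%g).
    exact: (finite_rank_comp (f := fun x : 'I_n * bool * G => x.2)
      (g := fun q => (q^-1)%g) _ memHV aH).
  apply: eq_finite_rank (finite_rankM (fun=> 1) inv_delta aH') => x q _ _.
  by rewrite mul1r.
apply: eq_finite_rank (finite_rank_sum kP) => -[y p] q _ _.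
rewrite (bigD1 y) //= big1 ?addr0 /k /=; first by rewrite eqxx !mul1r.
by move=> z zy; rewrite eq_sym (negbTE zy) !mul0r.
Qed.

Lemma polynomial_unit_kernel n (a : 'I_n -> G -> R[i]) x :
  (forall i, polynomial_fun R G (a i)) -> polynomial_fun R G (unit_kernel a x).
Proof.
move=> Pa; case: x => [[i []] p]; apply: polynomial_indic => /=.
  have c1 : continuous (fun _ : G => 1 : R[i]) by exact: cst_continuous.
  have m1 : {morph (fun _ : G => 1 : R[i]) : q r / (q * r)%g >-> q * r}.
    by move=> q r; rewrite mul1r.
  have := polynomial_inv c1 m1 (polynomial_mulgr p (Pa i)).
  by under eq_fun do rewrite mul1r.
exact: (polynomial_inv continuous_inv_delta inv_deltaM (polynomial_mulgl p (Pa i))).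
Qed.

(** All the functions [unit_kernel a x] lie in the span of finitely many of them,
    so that evaluation at the identity is given on all of them by one function
    [u], the conjugate of a combination of them. *)
Lemma polynomial_local_units :
  has_local_units (convolution mu) (polynomial_fun R G).
Proof.
move=> n a Pa; have [d [x [y [N [_ _ kE]]]]] :=
  finite_rank_skeleton (unit_kernel_finite_rank Pa).
have Pk i : polynomial_fun R G (unit_kernel a (x i)) := polynomial_unit_kernel _ Pa.
have Ck z : Cc R G (unit_kernel a z) by have /polyP[] := polynomial_unit_kernel z Pa.
have [c cE] := Riesz_evaluation hG haar 1%g (fun i => Ck (x i)).
pose u q := conjc (\sum_j c j * unit_kernel a (x j) q).
have Pu : polynomial_fun R G u by apply/polynomial_conj/polynomial_sum.
have /polyP[Cu _] := Pu.
have indicK q : indic q * indic q = indic q.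
  by rewrite /indic; case: (_ \in _); rewrite ?mulr1 ?mulr0.
have indic_u q : indic q * u q = u q.
  have -> : indic q = conjc (indic q) by rewrite conjc_nat.
  rewrite -rmorphM mulr_sumr; congr conjc; apply: eq_bigr => j _.
  by rewrite mulrCA /unit_kernel [indic q * (_ * _)]mulrA indicK.
have evu z : cintegral mu (fun q => unit_kernel a z q * u q) = unit_kernel a z 1%g.
  (* [x] and [y] are the rows and columns of the skeleton. *)
  pose b i := \sum_j unit_kernel a z (y j) * N j i.
  have zE q : unit_kernel a z q = \sum_i b i * unit_kernel a (x i) q.
    rewrite kE // exchange_big; apply: eq_bigr => i _.
    by rewrite mulr_suml.
  have Cku i : Cc R G (fun q => unit_kernel a (x i) q * u q).
    by apply: (Cc_mul hG (Ck _)); exact: Cc_continuous.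
  rewrite zE; under [in RHS]eq_bigr do rewrite -cE.
  rewrite -cintegral_sum //; congr cintegral; apply/funext => q.
  by rewrite zE mulr_suml; apply: eq_bigr => i _; rewrite mulrA.
have indic1 : indic 1%g = 1 by rewrite /indic mem_set.
exists u => // i; split; apply/funext => p.
  transitivity (unit_kernel a (i, true, p) 1%g); last first.
    by rewrite /unit_kernel /= indic1 mul1r invg1 mul1g.
  rewrite -evu; congr cintegral; apply/funext => q.
  by rewrite /unit_kernel /= [RHS]mulrAC indic_u.
transitivity (unit_kernel a (i, false, p) 1%g); last first.
  by rewrite /unit_kernel /= indic1 inv_delta1 !mul1r invg1 mulg1.
have /polyP[Ca _] := Pa i.
rewrite convolution_reflect // -evu; congr cintegral; apply/funext => q.
by rewrite /unit_kernel /= [RHS]mulrAC indic_u [RHS]mulrC.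
Qed.

End polynomial_functions.

Lemma local_units_nondegenerate (K : nzRingType) (V : lmodType K)
    (mul : V -> V -> V) (A : set V) :
  has_local_units mul A -> nondegenerate_product mul A.
Proof.
move=> locA; have unit1 a : A a -> exists2 u, A u & mul u a = a /\ mul a u = a.
  move=> Aa; have [//|u Au uE] := locA 1%N (fun=> a).
  by exists u => //; exact: uE ord0.
split=> a Aa a0; have [u Au [ua au]] := unit1 a Aa; first by rewrite -au a0.
by rewrite -ua a0.
Qed.

Theorem proposition5p16 (R : realType) (G : topologicalGroupType)
    (mu : {measure set (Borel G) -> \bar R}) (delta : G -> R)
    (hausdorffG : hausdorff_space G)
    (locally_compactG : locally_compact [set: G])
    (compact_open_subgroupG :
       exists H : set G, [/\ is_subgroup H, compact H & open H])
    (haar_mu : left_haar_measure mu)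
    (modular_delta : modular_function mu delta) :
  [/\ forall f f' : G -> R[i], Cc R G f -> Cc R G f' ->
        polynomial_fun R G f \/ polynomial_fun R G f' ->
        polynomial_fun R G (convolution mu f f'),
      two_sided_ideal (convolution mu) (Cc R G) (polynomial_fun R G) /\
        star_invariant (involution delta) (polynomial_fun R G),
      star_subalgebra (convolution mu) (involution delta)
        (Cc R G) (polynomial_fun R G),
      has_local_units (convolution mu) (polynomial_fun R G) &
      nondegenerate_product (convolution mu) (polynomial_fun R G)].
Proof.
have [H [sgH cH oH]] := compact_open_subgroupG.
have conv := polynomial_convolution hausdorffG sgH cH oH haar_mu.
have sub : subspace_of (Cc R G) (polynomial_fun R G) :=
  polynomial_subspace hausdorffG sgH cH oH.
have star : star_invariant (involution delta) (polynomial_fun R G).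
  exact: (polynomial_involution hausdorffG sgH cH oH modular_delta).
have units := polynomial_local_units hausdorffG sgH cH oH haar_mu modular_delta.
have PC f : polynomial_fun R G f -> Cc R G f by have [+ _] := sub; apply.
split=> //.
- split=> //; split=> // a b Ca Pb.
  by split; apply: conv => //; [exact: PC|right|exact: PC|left].
- by split=> //; split=> // a b Pa Pb; apply: conv; [exact: PC|exact: PC|left].
- exact: local_units_nondegenerate.
Qed.
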